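(* Let $b\in[n]$. The expected smoothness constant $\mathcal{L}=\mathcal{L}(b)$ of $b$-nice sampling satisfies $$\mathcal{L} \;\le\; \mathcal{L}_{\mathrm{simple}}(b) := \frac{n}{b}\,\frac{b-1}{n-1}\,\overline{L} + \frac{1}{b}\,\frac{n-b}{n-1}\,L_{\max}.$$
   Context: Let $n\ge 2$ and $d\ge 1$ be integers, $[n]=\{1,\dots,n\}$, let $a_1,\dots,a_n\in\mathbb{R}^d$, and let $U\ge 0$. (These come from a generalized linear model $f(w)=\frac1n\sum_{i=1}^n\phi_i(a_i^\top w)+\frac{\lambda}{2}\|w\|_2^2$ with convex $\phi_i$ satisfying $\phi_i''\le U$.) For nonempty $B\subseteq[n]$ define the subsample smoothness constant $$L_B:=\frac{U}{|B|}\lambda_{\max}\Big(\sum_{j\in B}a_ja_j^\top\Big),$$ where $\lambda_{\max}$ is the largest eigenvalue. Set $L_i:=L_{\{i\}}=U\|a_i\|_2^2$, $L_{\max}:=\max_{i\in[n]}L_i$, and $\overline{L}:=\frac1n\sum_{i=1}^nL_i$. A $b$-nice sampling is a random subset of $[n]$ uniformly distributed over all subsets of size $b$; its expected smoothness constant is $$\mathcal{L}:=\frac{1}{\binom{n-1}{b-1}}\max_{i\in[n]}\ \sum_{B\subseteq[n]:\,|B|=b,\ i\in B}L_B.$$ *)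

(* Defs.v *)
From mathcomp Require Import all_boot all_order all_algebra.
From mathcomp Require Import classical_sets reals.

Set Implicit Arguments.
Unset Strict Implicit.
Unset Printing Implicit Defensive.

Import Order.TTheory GRing.Theory Num.Theory.
Local Open Scope ring_scope.

(* The set of eigenvalues is finite, so [sup] is the largest eigenvalue as soon
   as one exists; this is the case for symmetric [A] of size [d >= 1].  MathComp
   eigenvalues are taken on row vectors, which is immaterial: [A] and [A^T]
   have the same eigenvalues. *)
Definition lambda_max (R : realType) (d : nat) (A : 'M[R]_d) : R :=
  sup [set x : R | eigenvalue A x]%classic.

Definition subsample_smoothness (R : realType) (n d : nat)
    (a : 'I_n -> 'cV[R]_d) (U : R) (B : {set 'I_n}) : R :=
  U / #|B|%:R * lambda_max (\sum_(j in B) a j *m (a j)^T).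

Definition smoothness (R : realType) (n d : nat)
    (a : 'I_n -> 'cV[R]_d) (U : R) (i : 'I_n) : R :=
  subsample_smoothness a U [set i].

(* Here and in [expected_smoothness], 0 is a neutral default for the maximum:
   for [0 <= U] all the quantities compared are nonnegative, because the
   matrices [\sum_(j in B) a j *m (a j)^T] are positive semidefinite. *)
Definition smoothness_max (R : realType) (n d : nat)
    (a : 'I_n -> 'cV[R]_d) (U : R) : R :=
  \big[Num.max/0]_(i < n) smoothness a U i.

Definition smoothness_avg (R : realType) (n d : nat)
    (a : 'I_n -> 'cV[R]_d) (U : R) : R :=
  n%:R^-1 * \sum_(i < n) smoothness a U i.

Definition expected_smoothness (R : realType) (n d : nat)
    (a : 'I_n -> 'cV[R]_d) (U : R) (b : nat) : R :=
  'C(n.-1, b.-1)%:R^-1 *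
  \big[Num.max/0]_(i < n)
    \sum_(B : {set 'I_n} | (#|B| == b) && (i \in B))
      subsample_smoothness a U B.

Definition expected_smoothness_simple (R : realType) (n d : nat)
    (a : 'I_n -> 'cV[R]_d) (U : R) (b : nat) : R :=
  n%:R / b%:R * ((b%:R - 1) / (n%:R - 1)) * smoothness_avg a U
  + b%:R^-1 * ((n%:R - b%:R) / (n%:R - 1)) * smoothness_max a U.

(* Main.v *)
(** Since [lambda_max] of a positive semidefinite matrix is at most its trace,
    [L_B <= |B|^-1 * \sum_(j in B) L_j].  Summing over the [b]-subsets containing
    [i], the index [i] itself is counted 'C(n-1, b-1) times and every other index
    (b-1)/(n-1) * 'C(n-1, b-1) times, which gives the simple bound with [L_i] in
    place of [L_max]. *)
Require Import Defs.
From mathcomp Require Import all_boot all_order all_algebra.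
From mathcomp Require Import classical_sets reals.
From mathcomp Require Import finset ring.

Set Implicit Arguments.
Unset Strict Implicit.
Unset Printing Implicit Defensive.

Import Order.TTheory GRing.Theory Num.Theory.
Local Open Scope ring_scope.

(** The map [setU A] is injective on the [k]-subsets of [~: A], and its image is the family counted
    here; the inverse is [B :\: A]. *)
Lemma card_supersets (T : finType) (A : {set T}) (k : nat) :
  #|[set B : {set T} | (A \subset B) && (#|B| == #|A| + k)%N]|
  = 'C(#|T| - #|A|, k).
Proof.
have -> : (#|T| - #|A|)%N = #|~: A| by rewrite [RHS]cardsCs setCK.
rewrite -cards_draws.
have inj : {in [set B : {set T} | B \subset ~: A & #|B| == k] &,
    injective (setU A)}.
  move=> B C; rewrite !inE -!disjoints_subset => /andP[BA _] /andP[CA _] E.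
  have := congr1 (fun X => X :\: A) E.
  by rewrite !setDUl !setDv !set0U; move: BA CA => /setDidPl -> /setDidPl ->.
rewrite -(card_in_imset inj); apply: eq_card => B; rewrite inE.
apply/andP/imsetP => [[AB /eqP cB] | [C]].
  exists (B :\: A); last by rewrite setDE setUIr setUCr setIT; apply/esym/setUidPr.
  by rewrite inE setDE subsetIr -setDE cardsDS // cB addKn eqxx.
rewrite inE -disjoints_subset => /andP[dis /eqP <-] ->.
split; first exact: subsetUl.
by rewrite cardsU setIC (disjoint_setI0 dis) cards0 subn0.
Qed.

(** After exchanging the sums, the weight of [s j] is the number of draws containing both [i] and
    [j], a count of supersets of [[set i]] or of [[set j; i]]. *)
Lemma sum_draws_containing (R : numFieldType) (m k : nat) (i : 'I_m.+2)
    (s : 'I_m.+2 -> R) :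
  \sum_(B : {set 'I_m.+2} | (#|B| == k.+1) && (i \in B)) \sum_(j in B) s j
  = 'C(m.+1, k)%:R * (s i + k%:R / m.+1%:R * \sum_(j | j != i) s j).
Proof.
rewrite (exchange_big_dep predT) //= (bigD1 i) //= mulrDr.
congr (_ + _).
  rewrite sumr_const mulr_natl; congr (_ *+ _).
  rewrite -[RHS]/'C(m.+2 - 1, k).
  rewrite -(cards1 i) -[X in 'C(X - _, _)](card_ord m.+2) -card_supersets.
  apply: eq_card => B; rewrite !inE sub1set cards1 unfold_in /=.
  by rewrite -andbA andbb andbC.
rewrite mulrA mulr_sumr; apply: eq_bigr => j ji.
rewrite sumr_const -[LHS]mulr_natl; congr (_ * _).
(* Clearing the denominator leaves an identity between natural numbers, which for [k > 0] is the
   absorption rule for binomials. *)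
apply: (@mulIf _ m.+1%:R); first by rewrite pnatr_eq0.
rewrite -mulrA divfK ?pnatr_eq0 // -!natrM; congr (_%:R).
(* For [k = 0] the draws are singletons, and none contains two distinct indices. *)
case: k => [|k].
  rewrite muln0; apply/eqP; rewrite muln_eq0 orbF; apply/eqP/eq_card0 => B.
  rewrite !inE unfold_in /=; apply/negP => /andP[/andP[/cards1P[x ->]]].
  by rewrite !inE => /eqP <-; rewrite (negPf ji).
rewrite mulnC [RHS]mulnC -mul_bin_diag; congr (_ * _)%N.
have -> : m.+1.-1 = (m.+2 - 2)%N by rewrite subn2.
have c2 : #|[set j; i]| = 2%N by rewrite cards2 ji.
rewrite -c2 -[X in 'C(X - _, _)](card_ord m.+2) -card_supersets.
apply: eq_card => B; rewrite !inE c2 subUset !sub1set unfold_in /=.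
by case: (i \in B); case: (j \in B); rewrite /= ?andbT ?andbF.
Qed.

Section RankOneSums.
Variables (R : realType) (d : nat).

Local Notation sqnorm x := (\sum_(k < d) x k ord0 ^+ 2).

(** Cauchy-Schwarz, from expanding the nonnegative sum of the squares of [q * y k - p * x k].
    Dividing by [q] requires [q > 0]; when [q = 0], [x] vanishes and so does [p]. *)
Lemma sqr_sum_mul_le (x y : 'I_d -> R) :
  (\sum_k x k * y k) ^+ 2 <= (\sum_k x k ^+ 2) * (\sum_k y k ^+ 2).
Proof.
set p := \sum_k x k * y k; set q := \sum_k x k ^+ 2; set r := \sum_k y k ^+ 2.
have q0 : 0 <= q by apply: sumr_ge0 => k _; exact: sqr_ge0.
have : 0 <= \sum_k (q * y k - p * x k) ^+ 2.
  by apply: sumr_ge0 => k _; exact: sqr_ge0.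
have -> : \sum_k (q * y k - p * x k) ^+ 2 = q * (q * r - p ^+ 2).
  transitivity (\sum_k (q ^+ 2 * y k ^+ 2 - 2 * q * p * (x k * y k)
      + p ^+ 2 * x k ^+ 2)); first by apply: eq_bigr => k _; ring.
  rewrite big_split sumrB -!mulr_sumr -/p -/q -/r /=; ring.
case: (ltgtP q 0) => [||q_eq0]; first by rewrite ltNge q0.
  by move=> qp; rewrite pmulr_rge0 // subr_ge0.
have x0 k : x k = 0.
  have := q_eq0; rewrite /q => /eqP; rewrite psumr_eq0; last first.
    by move=> j _; exact: sqr_ge0.
  by move/allP => /(_ k (mem_index_enum _)); rewrite /= sqrf_eq0 => /eqP.
have -> : p = 0 by apply: big1 => k _; rewrite x0 mul0r.
by rewrite q_eq0 !mul0r expr0n lexx.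
Qed.

(** Rayleigh quotient: for an eigenvector [v], [x * q] is the sum over [j] of the squared inner
    products of [v] with [a j], and Cauchy-Schwarz bounds each one. The bound is the trace of the
    matrix. *)
Lemma eigenvalue_sum_outer_le (I : finType) (B : {set I}) (a : I -> 'cV[R]_d)
    (x : R) :
  eigenvalue (\sum_(j in B) a j *m (a j)^T) x ->
  x <= \sum_(j in B) sqnorm (a j).
Proof.
move/eigenvalueP => [v vA v0].
pose q := \sum_k v ord0 k ^+ 2.
have q0 : 0 < q.
  rewrite lt_neqAle sumr_ge0 ?andbT => [|k _]; last exact: sqr_ge0.
  rewrite eq_sym psumr_eq0 => [|k _]; last exact: sqr_ge0.
  apply: contraNN v0 => /allP h; apply/eqP/rowP => k; rewrite mxE.
  by apply/eqP; rewrite -sqrf_eq0; exact: (h k (mem_index_enum _)).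
have : (v *m (\sum_(j in B) a j *m (a j)^T) *m v^T) ord0 ord0 = x * q.
  rewrite vA -scalemxAl mxE mxE; congr (_ * _).
  by apply: eq_bigr => k _; rewrite mxE expr2.
rewrite mulmx_sumr mulmx_suml summxE => E.
rewrite -(ler_pM2r q0) -E mulr_suml; apply: ler_sum => j _.
have -> : (v *m (a j *m (a j)^T) *m v^T) ord0 ord0
    = (\sum_k v ord0 k * a j k ord0) ^+ 2.
  by rewrite mulmxA -mulmxA -trmx_mul mxE big_ord1 !mxE expr2.
by rewrite mulrC; exact: sqr_sum_mul_le.
Qed.

Lemma lambda_max_sum_outer_le (I : finType) (B : {set I}) (a : I -> 'cV[R]_d) :
  lambda_max (\sum_(j in B) a j *m (a j)^T) <= \sum_(j in B) sqnorm (a j).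
Proof.
rewrite /lambda_max; set E := (X in sup X).
(* Treating an empty spectrum apart, where [sup] is 0, avoids proving that an eigenvalue exists. *)
have [->|ne] := eqVneq E classical_sets.set0.
  by rewrite sup0; apply: sumr_ge0 => j _; apply: sumr_ge0 => k _; exact: sqr_ge0.
apply: ge_sup; first exact/set0P.
by move=> x; exact: eigenvalue_sum_outer_le.
Qed.

(** The trace bound is attained: [(a i)^T] is an eigenvector with eigenvalue the squared norm. If
    [a i = 0], the all-ones vector serves instead, nonzero because [d > 0]. *)
Lemma lambda_max_outer (I : finType) (a : I -> 'cV[R]_d) (i : I) :
  (0 < d)%N ->
  lambda_max (\sum_(j in [set i]) a j *m (a j)^T) = sqnorm (a i).
Proof.
move=> d0; apply/eqP; rewrite eq_le.
have := lambda_max_sum_outer_le [set i] a.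
rewrite [X in _ <= X]big_set1 => -> /=; apply: ub_le_sup.
  by exists (\sum_(j in [set i]) sqnorm (a j)) => x; exact: eigenvalue_sum_outer_le.
rewrite /= big_set1; apply/eigenvalueP.
have [ai0|ai0] := eqVneq (a i) 0.
  exists (const_mx 1).
    by rewrite ai0 mul0mx mulmx0 big1 ?scale0r // => k _; rewrite mxE expr0n.
  apply/eqP => /rowP /(_ (Ordinal d0)); rewrite !mxE => /eqP.
  by rewrite oner_eq0.
exists (a i)^T; last by rewrite trmx_eq0.
rewrite mulmxA [_ *m a i]mx11_scalar mul_scalar_mx; congr (_ *: _).
by rewrite mxE; apply: eq_bigr => k _; rewrite mxE expr2.
Qed.

End RankOneSums.

Lemma smoothnessE (R : realType) (n d : nat) (a : 'I_n -> 'cV[R]_d) (U : R)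
    (i : 'I_n) :
  (0 < d)%N -> smoothness a U i = U * \sum_(k < d) a i k ord0 ^+ 2.
Proof.
move=> d0.
by rewrite /smoothness /subsample_smoothness lambda_max_outer // cards1 divr1.
Qed.

Lemma subsample_smoothness_le (R : realType) (n d : nat)
    (a : 'I_n -> 'cV[R]_d) (U : R) (B : {set 'I_n}) :
  (0 < d)%N -> 0 <= U ->
  subsample_smoothness a U B <= #|B|%:R^-1 * \sum_(j in B) smoothness a U j.
Proof.
move=> d0 U0; under eq_bigr do rewrite smoothnessE //.
rewrite -mulr_sumr mulrA [_^-1 * U]mulrC; apply: ler_wpM2l.
  by rewrite divr_ge0.
exact: lambda_max_sum_outer_le.
Qed.

Theorem theorem2 (R : realType) (n d : nat) (hn : (2 <= n)%N) (hd : (1 <= d)%N)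
    (a : 'I_n -> 'cV[R]_d) (U : R) (hU : 0 <= U)
    (b : nat) (hb : (1 <= b <= n)%N) :
  expected_smoothness a U b <= expected_smoothness_simple a U b.
Proof.
(* From here on [n] is [m.+2] and [b] is [k.+1]. *)
case: n hn a hb => [|[|m]] // _ a; case: b => [|k] //= km.
have s0 i : 0 <= smoothness a U i.
  by rewrite smoothnessE // mulr_ge0 // sumr_ge0 // => j _; exact: sqr_ge0.
have C0 : 0 < 'C(m.+1, k)%:R :> R by rewrite ltr0n bin_gt0.
have m0 : m.+1%:R != 0 :> R by rewrite pnatr_eq0.
have k0 : k.+1%:R != 0 :> R by rewrite pnatr_eq0.
have n0 : m.+2%:R != 0 :> R by rewrite pnatr_eq0.
have mB : m.+2%:R - 1 = m.+1%:R :> R by rewrite -natr1 addrK.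
have kB : k.+1%:R - 1 = k%:R :> R by rewrite -natr1 addrK.
have nkB : m.+2%:R - k.+1%:R = (m.+1 - k)%:R :> R by rewrite -natrB.
rewrite /expected_smoothness /expected_smoothness_simple mB kB nkB /=.
(* Bounding the maximum also requires the right-hand side to dominate the default 0. *)
rewrite mulrC ler_pdivrMr //; apply: bigmax_le => [|i _].
  rewrite mulr_ge0 ?ler0n // addr_ge0 // ?mulr_ge0 ?invr_ge0 ?ler0n //.
    exact: sumr_ge0.
  exact: bigmax_ge_id.
apply: (@le_trans _ _ (k.+1%:R^-1 *
   \sum_(B : {set 'I_m.+2} | (#|B| == k.+1) && (i \in B))
     \sum_(j in B) smoothness a U j)).
  rewrite mulr_sumr; apply: ler_sum => B /andP[/eqP cB _].
  by rewrite -cB; exact: subsample_smoothness_le.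
rewrite sum_draws_containing mulrCA [leRHS]mulrC ler_pM2l //.
(* Completing the sum over [j != i] to the full sum uses up [k / m.+1] of the unit coefficient of
   [L_i]; the remainder is [(m.+1 - k) / m.+1]. Only then is [L_i] bounded by [L_max]. *)
have -> : k.+1%:R^-1 * (smoothness a U i
      + k%:R / m.+1%:R * \sum_(j | j != i) smoothness a U j)
    = m.+2%:R / k.+1%:R * (k%:R / m.+1%:R) * smoothness_avg a U
      + k.+1%:R^-1 * ((m.+1 - k)%:R / m.+1%:R) * smoothness a U i.
  rewrite /smoothness_avg [\sum_(j < m.+2) _](bigD1 i) //= natrB //.
  by field; rewrite !nat1r -(natrD _ 2) m0 k0 n0.
rewrite lerD2l; apply: ler_wpM2l; last exact: le_bigmax.
by rewrite mulr_ge0 ?divr_ge0 ?invr_ge0 ?ler0n.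
Qed.
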